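(* Let $\Sigma$ be a finitely aligned $k$-graph. Suppose $I$ is a gauge-invariant ideal of $C^*(\Sigma)$. Let \[ H_I:=\{v\in\Sigma^0:s_v^\Sigma\in I\},\quad B_I:=\big\{E\in\mathrm{FE}(\Sigma\setminus\Sigma H_I):\Delta(s^\Sigma)^E\in I\big\},\quad \tilde{B}_I:=\Big\{E\in B_I:E\subseteq\bigcup_{j=1}^k\Sigma^{e_j}\Big\}, \] and let $J$ denote the ideal of $C^*(\Sigma)$ generated by the projections $\{\Delta(s^\Sigma)^E:E\in\tilde{B}_I\}$. Then \[ E\in B_I\implies\Delta(s^\Sigma)^E\in J. \]
   Context: Here $\mathbb{N}^k$ includes $0$, $e_1,\ldots,e_k$ are its standard generators, and $m\vee n$ is the componentwise maximum. A $k$-graph is a countable small category $\Sigma$ with a functor $d:\Sigma\to\mathbb{N}^k$ such that for all $\lambda\in\Sigma$ and $m,n\in\mathbb{N}^k$ with $d(\lambda)=m+n$ there are unique $\mu,\nu\in\Sigma$ with $d(\mu)=m$, $d(\nu)=n$, $\lambda=\mu\nu$. $\Sigma^n:=d^{-1}(n)$; $\Sigma^0$ is the set of identity morphisms (vertices); $r(\lambda),s(\lambda)\in\Sigma^0$ are the identities at the codomain and domain of $\lambda$. $\mathrm{MCE}(\mu,\nu):=\mu\Sigma\cap\nu\Sigma\cap\Sigma^{d(\mu)\vee d(\nu)}$ and $\Sigma^{\min}(\mu,\nu):=\{(\alpha,\beta):\mu\alpha=\nu\beta\in\mathrm{MCE}(\mu,\nu)\}$. $\Sigma$ is finitely aligned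 if every $\Sigma^{\min}(\mu,\nu)$ is finite. A set $E\subseteq v\Sigma$ ($v\in\Sigma^0$) is exhaustive in $\Sigma$ if for each $\mu\in v\Sigma$ there is $\nu\in E$ with $\Sigma^{\min}(\mu,\nu)\neq\emptyset$; $\mathrm{FE}(\Sigma)$ is the collection of finite exhaustive sets $E\subseteq v\Sigma\setminus\{v\}$, $v\in\Sigma^0$. A Toeplitz--Cuntz--Krieger $\Sigma$-family in a $C^*$-algebra is a collection $\{q_\lambda:\lambda\in\Sigma\}$ with (TCK1) $\{q_v:v\in\Sigma^0\}$ mutually orthogonal projections; (TCK2) $q_\mu q_\nu=q_{\mu\nu}$ if $s(\mu)=r(\nu)$; (TCK3) $q_\mu^*q_\nu=\sum_{(\alpha,\beta)\in\Sigma^{\min}(\mu,\nu)}q_\alpha q_\beta^*$ (empty sum is $0$). For finite $E\subseteq v\Sigma$, $\Delta(q)^E:=\prod_{\lambda\in E}(q_v-q_\lambda q_\lambda^* )$. It is a Cuntz--Krieger $\Sigma$-family if also (CK) $\Delta(q)^E=0$ for every $E\in\mathrm{FE}(\Sigma)$. $C^*(\Sigma)$ is the universal $C^*$-algebra generated by a Cuntz--Krieger $\Sigma$-family $\{s_\lambda^\Sigma\}$. The gauge action $\gamma^\Sigma:\mathbb{T}^k\to\mathrm{Aut}(C^*(\Sigma))$ satisfies $\gamma_z^\Sigma(s_\lambda^\Sigma)=z^{d(\lambda)}s_\lambda^\Sigma$; an ideal is gauge-invariant if it is invariant under all $\gamma_z^\Sigma$. For a gauge-invariant ideal $I$, $\Sigma\setminus\Sigma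 H_I:=\{\lambda\in\Sigma:s(\lambda)\notin H_I\}$ is itself a finitely aligned $k$-graph, and $\mathrm{FE}(\Sigma\setminus\Sigma H_I)$ is formed with respect to this $k$-graph. *)

(* Defs.v *)
From HB Require Import structures.
From mathcomp Require Import all_boot all_order all_algebra.
From mathcomp Require Import finmap complex.
From mathcomp Require Import all_classical all_reals all_analysis.

Set Implicit Arguments.
Unset Strict Implicit.
Unset Printing Implicit Defensive.

Import Order.TTheory GRing.Theory Num.Theory.
Import numFieldNormedType.Exports.

Local Open Scope classical_set_scope.
Local Open Scope ring_scope.

(** * C*-algebras *)

(* Not necessarily unital: C*(Sigma) has a unit only if Sigma has finitely many
   vertices.  The norm of a normed module over [R[i]] takes its values in
   [R[i]], where [0 <= x] entails that x is real. *)
HB.mixin Record isCStarAlgebra (R : realType) A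
    of CompleteNormedModule R[i] A := {
  cmul : A -> A -> A;
  star : A -> A;
  cmulA : forall x y z, cmul x (cmul y z) = cmul (cmul x y) z;
  cmulDl : forall x y z, cmul (x + y) z = cmul x z + cmul y z;
  cmulDr : forall x y z, cmul x (y + z) = cmul x y + cmul x z;
  cmulZl : forall (a : R[i]) x y, cmul (a *: x) y = a *: cmul x y;
  cmulZr : forall (a : R[i]) x y, cmul x (a *: y) = a *: cmul x y;
  starK : forall x, star (star x) = x;
  starD : forall x y, star (x + y) = star x + star y;
  starZ : forall (a : R[i]) x, star (a *: x) = conjc a *: star x;
  starM : forall x y, star (cmul x y) = cmul (star y) (star x);
  norm_cmul : forall x y, `|cmul x y| <= `|x| * `|y|;
  norm_star_cmul : forall x, `|cmul (star x) x| = `|x| ^+ 2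
}.

#[short(type="cstarAlgType")]
HB.structure Definition CStarAlgebra (R : realType) :=
  { A of isCStarAlgebra R A & CompleteNormedModule R[i] A }.

Notation "x ** y" := (cmul x y) (at level 40, left associativity) : ring_scope.

Section CStarNotions.
Context {R : realType}.

Definition is_star_hom {A B : cstarAlgType R} (f : A -> B) : Prop :=
  [/\ linear f,
      forall x y, f (x ** y) = f x ** f y
    & forall x, f (star x) = star (f x)].

Definition is_star_aut {A : cstarAlgType R} (f : A -> A) : Prop :=
  is_star_hom f /\ bijective f.

Definition is_cstar_subalgebra {A : cstarAlgType R} (B : set A) : Prop :=
  [/\ B 0, forall (a : R[i]) x y, B x -> B y -> B (a *: x + y),
      forall x y, B x -> B y -> B (x ** y),
      forall x, B x -> B (star x)
    & closed B].

Definition is_ideal {A : cstarAlgType R} (I : set A) : Prop :=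
  [/\ I 0, forall (a : R[i]) x y, I x -> I y -> I (a *: x + y),
      forall a x, I x -> I (a ** x),
      forall a x, I x -> I (x ** a)
    & closed I].

Definition ideal_generated {A : cstarAlgType R} (X : set A) : set A :=
  [set a | forall I : set A, is_ideal I -> X `<=` I -> I a].

End CStarNotions.

(** * k-graphs *)

Notation degree k := {ffun 'I_k -> nat}.

Definition djoin {k} (m n : degree k) : degree k :=
  [ffun i => maxn (m i) (n i)].

Definition dgen {k} (j : 'I_k) : degree k := [ffun i => (i == j) : nat].

(* The value of [mcomp mu nu] is irrelevant unless [dom mu = cod nu]. *)
Record kgraph (k : nat) := KGraph {
  obj : Type;
  mor :> countType;
  dom : mor -> obj;
  cod : mor -> obj;
  idm : obj -> mor;
  mcomp : mor -> mor -> mor;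
  deg : mor -> degree k;
  dom_idm : forall v, dom (idm v) = v;
  cod_idm : forall v, cod (idm v) = v;
  dom_mcomp : forall mu nu, dom mu = cod nu -> dom (mcomp mu nu) = dom nu;
  cod_mcomp : forall mu nu, dom mu = cod nu -> cod (mcomp mu nu) = cod mu;
  mcomp_idl : forall mu, mcomp (idm (cod mu)) mu = mu;
  mcomp_idr : forall mu, mcomp mu (idm (dom mu)) = mu;
  mcompA : forall la mu nu, dom la = cod mu -> dom mu = cod nu ->
    mcomp la (mcomp mu nu) = mcomp (mcomp la mu) nu;
  deg_idm : forall v, deg (idm v) = 0;
  deg_mcomp : forall mu nu, dom mu = cod nu ->
    deg (mcomp mu nu) = deg mu + deg nu;
  factorisation : forall la (m n : degree k), deg la = m + n ->
    exists! p : mor * mor,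
      [/\ dom p.1 = cod p.2, deg p.1 = m, deg p.2 = n & la = mcomp p.1 p.2]
}.

Section KGraphNotions.
Context {k : nat} {S : kgraph k}.
Implicit Types (G : set S) (E : {fset S}).

Definition rng (la : S) : S := idm (cod la).
Definition src (la : S) : S := idm (dom la).
Definition vertices : set S := range (@idm k S).

(* The next notions are those of a sub-k-graph [G] of [S], with the morphisms
   of [G] as the only morphisms available; [G = setT] gives those of [S]. *)

Definition MCE G (mu nu : S) : set S :=
  [set la | [/\ exists al, [/\ G al, src mu = rng al & la = mcomp mu al],
                exists be, [/\ G be, src nu = rng be & la = mcomp nu be],
                G la
              & deg la = djoin (deg mu) (deg nu)]].

Definition min_ext G (mu nu : S) : set (S * S) :=
  [set p | [/\ G p.1 /\ G p.2, src mu = rng p.1, src nu = rng p.2,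
               mcomp mu p.1 = mcomp nu p.2
             & MCE G mu nu (mcomp mu p.1)]].

Definition exhaustive G (v : S) E : Prop :=
  forall mu, G mu -> rng mu = v ->
    exists2 nu, nu \in E & min_ext G mu nu !=set0.

(* Those E in FE(G) that lie in vG.  Exhaustive sets are non-empty because
   v itself is in vG, so that E determines v. *)
Definition FE G (v : S) : set {fset S} :=
  [set E : {fset S} | [/\ vertices v, G v,
               forall la, la \in E -> [/\ G la, rng la = v & la <> v]
             & exhaustive G v E]].

(* G is closed under range, source, composition and factorisation, and hence
   is a k-graph with the structure inherited from [S]. *)
Definition is_sub_kgraph G : Prop :=
  (forall la, G la -> G (rng la) /\ G (src la)) /\
  (forall mu nu, src mu = rng nu -> G (mcomp mu nu) <-> G mu /\ G nu).

End KGraphNotions.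

Definition finitely_aligned {k} (S : kgraph k) : Prop :=
  forall mu nu : S, finite_set (min_ext setT mu nu).

(** * Cuntz-Krieger families and C*(Sigma) *)

Section Families.
Context {R : realType} {k : nat} {S : kgraph k} {A : cstarAlgType R}.
Implicit Types (q : S -> A).

Definition is_TCK_family q : Prop :=
  [/\ (forall v, vertices v -> star (q v) = q v /\ q v ** q v = q v) /\
      (forall u v, vertices u -> vertices v -> u <> v -> q u ** q v = 0),
      forall mu nu, src mu = rng nu -> q mu ** q nu = q (mcomp mu nu)
    & forall mu nu, star (q mu) ** q nu =
        \sum_(p \in min_ext setT mu nu) q p.1 ** star (q p.2)].

(* A may lack a unit; the product over E is therefore taken in the corner
   q_v A q_v, whose unit q_v serves as the empty product.  The factors commute
   when q is a Toeplitz-Cuntz-Krieger family and [E] is contained in vS. *)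
Definition gap q (v : S) (E : {fset S}) : A :=
  \big[cmul/q v]_(la <- E) (q v - q la ** star (q la)).

Definition is_CK_family q : Prop :=
  is_TCK_family q /\ forall v E, FE setT v E -> gap q v E = 0.

Definition generates q : Prop :=
  forall B : set A, is_cstar_subalgebra B -> range q `<=` B -> B = setT.

End Families.

(* (A, s) is C*(S) with its canonical generators.  The homomorphism f is unique
   because s generates A. *)
Definition is_universal_CK {R : realType} {k} {S : kgraph k}
    {A : cstarAlgType R} (s : S -> A) : Prop :=
  [/\ is_CK_family s, generates s
    & forall (B : cstarAlgType R) (t : S -> B), is_CK_family t ->
        exists2 f : A -> B, is_star_hom f & forall la, f (s la) = t la].

Section GaugeInvariantIdeals.
Context {R : realType} {k : nat} {S : kgraph k} {A : cstarAlgType R}.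
Variable s : S -> A.

Definition torus : set ('I_k -> R[i]) := [set z | forall j, `|z j| = 1].

Definition torus_pow (z : 'I_k -> R[i]) (n : degree k) : R[i] :=
  \prod_(j < k) z j ^+ n j.

(* When s generates A, these conditions determine gamma on the torus and make
   it a group homomorphism there. *)
Definition is_gauge_action (gamma : ('I_k -> R[i]) -> A -> A) : Prop :=
  forall z, torus z -> is_star_aut (gamma z) /\
    forall la, gamma z (s la) = torus_pow z (deg la) *: s la.

Definition gauge_invariant (gamma : ('I_k -> R[i]) -> A -> A) (I : set A) :=
  forall z, torus z -> forall a, I a -> I (gamma z a).

Definition H_ (I : set A) : set S := [set v | vertices v /\ I (s v)].

Definition outside (I : set A) : set S := [set la | ~ H_ I (src la)].

(* Those E in B_I that lie in vS. *)
Definition B_ (I : set A) (v : S) : set {fset S} :=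
  [set E : {fset S} | FE (outside I) v E /\ I (gap s v E)].

Definition Bt_ (I : set A) (v : S) : set {fset S} :=
  [set E : {fset S} |
    B_ I v E /\ forall la, la \in E -> exists j, deg la = dgen j].

Definition J_ (I : set A) : set A :=
  ideal_generated [set a | exists v (E : {fset S}), Bt_ I v E /\ a = gap s v E].

End GaugeInvariantIdeals.

Lemma deg0_idm k (S : kgraph k) (la : S) : deg la = 0 -> la = idm (dom la).
Proof.
move=> d0; have := @factorisation _ _ la 0 0.
rewrite addr0 => /(_ d0) [p [_ up]].
have e1 := up (la, idm (dom la)).
have e2 := up (idm (cod la), la).
have {}e1 : p = (la, idm (dom la)).
  by apply: e1; split; rewrite /= ?cod_idm ?deg_idm ?mcomp_idr.
have : p = (idm (cod la), la).
  by apply: e2; split; rewrite /= ?dom_idm ?deg_idm ?mcomp_idl.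
by rewrite e1 => -[].
Qed.

Lemma min_ext_diag k (S : kgraph k) (la : S) :
  min_ext setT la la = [set (src la, src la)].
Proof.
apply/seteqP; split=> -[a b] /=; last first.
  move=> [-> ->]; split=> //=; rewrite /rng /src ?cod_idm //.
  rewrite mcomp_idr; split => //; try by exists (idm (dom la));
    rewrite /rng ?cod_idm ?mcomp_idr.
  by apply/ffunP => i; rewrite ffunE maxnn.
have idm_inj : injective (@idm k S).
  by move=> u v /(congr1 (@dom k S)); rewrite !dom_idm.
move=> [_ /= /idm_inj ca /idm_inj cb e [_ _ _ dl]].
have aux c : dom la = cod c -> mcomp la c = mcomp la a -> c = src la.
  move=> cc ec; have := dl; rewrite -ec deg_mcomp // => dlc.
  have d0 : deg c = 0.
    apply/ffunP => i; move/ffunP: dlc => /(_ i); rewrite !ffunE maxnn.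
    by rewrite -[RHS]addn0 => /addnI.
  by rewrite (deg0_idm d0) /src cc {2}(deg0_idm d0) cod_idm.
by rewrite (aux a) // (aux b).
Qed.

(* The notions of [FE (outside s I)] are thus those of a k-graph. *)
Lemma outside_sub_kgraph (R : realType) k (S : kgraph k) (A : cstarAlgType R)
    (s : S -> A) (I : set A) :
  is_TCK_family s -> is_ideal I -> is_sub_kgraph (outside s I).
Proof.
move=> fam [I0 _ Il Ir _]; have [_ tck2 tck3] := fam.
have vI o : @vertices k S (idm o) by exists o.
have her la : outside s I la -> outside s I (rng la).
  move=> nl; rewrite /outside /= => -[_ H]; apply: nl; split; first exact: vI.
  have sl : I (s la).
    rewrite -[la]mcomp_idl -tck2; last by rewrite /src /rng dom_idm.
    by move: H; rewrite /src /rng dom_idm; apply: Ir.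
  have [[tck1 _] _ _] := fam.
  have := Il (star (s la)) _ sl; rewrite tck3 min_ext_diag fsbig_set1 /=.
  by have [-> ->] := tck1 _ (vI (dom la)).
split=> [la nl|mu nu e].
- split; first exact: her.
  by rewrite /outside /= {1}/src /src dom_idm.
- have idm_inj : injective (@idm k S).
    by move=> u v /(congr1 (@dom k S)); rewrite !dom_idm.
  have es : src (mcomp mu nu) = src nu.
    by rewrite /src dom_mcomp //; apply: idm_inj.
  rewrite /outside /= es; split=> [h|[]//]; split=> //.
  have := her _ h. by rewrite /outside /= e /rng /src dom_idm.
Qed.

(* Main.v *)
Require Import Defs.
From mathcomp Require Import all_boot all_order all_algebra.
From mathcomp Require Import finmap complex.
From mathcomp Require Import all_classical all_reals all_analysis.

(** Write [G] for the paths whose source is not in [H_I]; it is a sub-k-graph.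
    Let [K] be an ideal containing the gaps of all edge sets in [B_I], and let
    [E] be in [B_I] with [E] in [vG]. The gap of [E] is shown to lie in [K] by
    induction on the total degree of the join of the degrees of the members of
    [E].

    Replace each path in [E] by one of its initial edges. The resulting set
    [F] is still exhaustive in [G] ([edge_prefixes]), and its gap lies below
    that of [E], hence in [I] ([gap_coarser]). So the gap of [F] is in [K]. As
    [q_v - gap F] is a sum of terms [q_f x] with [f] in [F], it remains
    to see that [gap E q_f] is in [K] for each edge [f] in [F]
    ([ideal_absorb_gap]).

    Let [X] be the set of all [b] in [G] with [f b] a minimal common extension
    of [f] and a member of [E] ([exts]). If [X] contains the vertex [s(f)],
    then [f] itself extends a member of [E] and [gap E q_f = 0]. Otherwise [X]
    is again finite exhaustive in [G] ([exts_FE]). Up to terms in [I],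
    [gap X] is [q_f^* gap E q_f]: the minimal common extensions that leave [G]
    end in [H_I]. So [gap X] is in [I] ([gap_exts_ideal]) and [X] is in [B_I].
    If [f] has degree [e_j], then some path in [E] has positive [j]-th degree,
    and passing from [E] to [X] lowers the [j]-th entry of the join by at
    least one without raising the others. By induction [gap X] is in [K]. Since
    [gap E q_f q_b = 0] for [b] in [X], also [gap E q_f = gap E q_f gap X] is
    in [K] ([gap_mul_exts]). *)

Set Implicit Arguments.
Unset Strict Implicit.
Unset Printing Implicit Defensive.

Import GRing.Theory.
Local Open Scope classical_set_scope.
Local Open Scope ring_scope.

(** * Factorisation and common extensions in a k-graph *)

Section Factorisation.
Context {k : nat} {S : kgraph k}.
Implicit Types (G : set S) (la mu nu al be : S) (E : {fset S}).

Lemma idm_inj : injective (@idm k S).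
Proof. by move=> u v /(congr1 (@dom k S)); rewrite !dom_idm. Qed.

Lemma src_rngE mu nu : (src mu = rng nu) <-> (dom mu = cod nu).
Proof. by split=> [/idm_inj //|e]; rewrite /src /rng e. Qed.

Lemma rng_mcomp mu nu : dom mu = cod nu -> rng (mcomp mu nu) = rng mu.
Proof. by move=> e; rewrite /rng cod_mcomp. Qed.

Lemma factor_at la (m : degree k) : (forall i, m i <= deg la i)%N ->
  exists mu nu, [/\ dom mu = cod nu, deg mu = m & la = mcomp mu nu].
Proof.
move=> le; have dE : deg la = m + [ffun i => deg la i - m i]%N.
  by apply/ffunP => i; rewrite !ffunE [_ + _]subnKC.
have [[mu nu] [[/= h1 h2 _ h4] _]] := factorisation dE.
by exists mu, nu.
Qed.

Lemma factor_inj mu1 nu1 mu2 nu2 : dom mu1 = cod nu1 -> dom mu2 = cod nu2 ->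
  deg mu1 = deg mu2 -> mcomp mu1 nu1 = mcomp mu2 nu2 -> mu1 = mu2 /\ nu1 = nu2.
Proof.
move=> c1 c2 d e; have dn : deg nu1 = deg nu2.
  have := congr1 (@deg k S) e; rewrite !deg_mcomp // d => /ffunP dE.
  by apply/ffunP => i; have := dE i; rewrite !ffunE => /addnI.
have [p [_ up]] := factorisation (deg_mcomp c1).
have e1 : p = (mu1, nu1) by apply: up.
have : p = (mu2, nu2) by apply: up; split.
by rewrite e1 => -[].
Qed.

(** Cutting a common extension [mu al = nu be] at degree
    [deg mu \vee deg nu] leaves a minimal common extension, because both [mu]
    and [nu] are then initial segments of the first piece. *)
Lemma common_ext_min_ext G mu nu al be : is_sub_kgraph G ->
  G al -> G be -> G (mcomp mu al) ->
  dom mu = cod al -> dom nu = cod be -> mcomp mu al = mcomp nu be ->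
  exists a b t, [/\ min_ext G mu nu (a, b), G t,
    dom a = cod t, al = mcomp a t & be = mcomp b t].
Proof.
move=> [_ subG] Gal Gbe Gla ca cb e.
have le i : (djoin (deg mu) (deg nu) i <= deg (mcomp mu al) i)%N.
  rewrite ffunE geq_max {2}e !deg_mcomp // !ffunE.
  by apply/andP; split; apply: leq_addr.
have [rho [t [crt drho eq_la]]] := factor_at le.
(* An initial segment of [rho t] of degree at most [deg rho] is one of [rho]. *)
have prefix x y : dom x = cod y -> (forall i, deg x i <= deg rho i)%N ->
    mcomp x y = mcomp rho t ->
    exists z, [/\ dom x = cod z, dom z = cod t, rho = mcomp x z
                & y = mcomp z t].
  move=> cxy lex exy; have [x' [z [cz dx ez]]] := factor_at lex.
  have czt : dom z = cod t by rewrite -crt ez dom_mcomp.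
  have [exx' ey] : x = x' /\ y = mcomp z t.
    by apply: factor_inj; rewrite ?cod_mcomp // exy ez mcompA.
  by exists z; split => //; rewrite exx'.
have [a [xa at_ era eal]] : exists z, [/\ dom mu = cod z, dom z = cod t,
    rho = mcomp mu z & al = mcomp z t].
  by apply: prefix => // i; rewrite drho ffunE leq_maxl.
have [b [xb bt erb ebe]] : exists z, [/\ dom nu = cod z, dom z = cod t,
    rho = mcomp nu z & be = mcomp z t].
  by apply: prefix; rewrite -?e // => i; rewrite drho ffunE leq_maxr.
have Gcomp x y : dom x = cod y -> G (mcomp x y) -> G x /\ G y.
  by move=> c; apply: (subG _ _ _).1; apply/src_rngE.
have [Ga Gt] : G a /\ G t by apply: Gcomp; rewrite -?eal.
have [Gb _] : G b /\ G t by apply: Gcomp; rewrite -?ebe.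
have [Grho _] : G rho /\ G t by apply: Gcomp; rewrite -?eq_la.
exists a, b, t; split => //; split => //=.
- exact/src_rngE.
- exact/src_rngE.
- by rewrite -era.
- split; last by rewrite -era.
  + by exists a; split => //; apply/src_rngE.
  + by exists b; split; [|apply/src_rngE|rewrite -era].
  + by rewrite -era.
Qed.

Lemma min_ext_setT G mu nu p : min_ext G mu nu p -> min_ext setT mu nu p.
Proof.
move=> [_ c1 c2 e [[x [_ ? ?]] [y [_ ? ?]] _ d]].
by split => //; split => //; [exists x|exists y].
Qed.

Lemma min_extC G mu nu a b : min_ext G mu nu (a, b) -> min_ext G nu mu (b, a).
Proof.
move=> [/= [Ga Gb] c1 c2 e [x y g d]]; rewrite e in x y g d.
split => //=; split => //.
by rewrite d; apply/ffunP => i; rewrite !ffunE maxnC.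
Qed.

(** A composite is in [G] exactly when both factors are, so [mu a] puts [b]
    into [G]. *)
Lemma min_ext_sub G mu nu a b : is_sub_kgraph G -> G mu -> G a ->
  min_ext setT mu nu (a, b) -> min_ext G mu nu (a, b).
Proof.
move=> [_ Gsub] Gmu Ga [/= _ c1 c2 e [_ _ _ d]].
have Gma : G (mcomp mu a) by apply/(Gsub _ _ c1).
have Gb : G b by move: Gma; rewrite e => /(Gsub _ _ c2) [].
by split => //; split => //; [exists a|exists b].
Qed.

Lemma deg_min_ext G mu nu a b i :
  min_ext G mu nu (a, b) -> deg a i = (maxn (deg mu i) (deg nu i) - deg mu i)%N.
Proof.
move=> [/= _ /src_rngE c _ _ [_ _ _ /ffunP /(_ i)]].
by rewrite deg_mcomp // !ffunE => <-; rewrite [(_ + _)%R]addnC addnK.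
Qed.

Lemma deg_dgen_gt0 la j : (0 < deg la j)%N ->
  exists f mu, [/\ dom f = cod mu, deg f = dgen j & la = mcomp f mu].
Proof.
by move=> lt0; apply: factor_at => i; rewrite ffunE; case: eqP => // ->.
Qed.

Lemma FE_deg_gt0 G v E la : FE G v E -> la \in E -> exists j, (0 < deg la j)%N.
Proof.
move=> [_ _ hE _] /hE [_ rla nla]; apply: contrapT => nj; apply: nla.
rewrite -rla /rng; have d0 : deg la = 0.
  apply/ffunP => i; rewrite ffunE; apply/eqP; rewrite -leqn0 leqNgt.
  by apply/negP => lt0; apply: nj; exists i.
by rewrite (deg0_idm d0) cod_idm.
Qed.

(** Replacing every path of an exhaustive set by one of its initial edges
    keeps the set exhaustive: it only makes it easier to have a common
    extension with a member. *)
Lemma edge_prefixes G v E : is_sub_kgraph G -> FE G v E ->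
  exists F : {fset S}, [/\ FE G v F,
    forall f, f \in F -> exists2 j, deg f = dgen j &
      exists2 la, la \in E & (0 < deg la j)%N &
    forall la, la \in E -> exists f mu,
      [/\ f \in F, dom f = cod mu & la = mcomp f mu]].
Proof.
move=> Gsub EF; have [vv Gv hE exE] := EF.
have /choice [g gP] la : exists f, la \in E -> exists j mu,
    [/\ (0 < deg la j)%N, dom f = cod mu, deg f = dgen j & la = mcomp f mu].
  have [laE|/negP nE] := boolP (la \in E); last by exists la.
  have [j lt0] := FE_deg_gt0 EF laE.
  by have [f [mu [? ? ?]]] := deg_dgen_gt0 lt0; exists f => _; exists j, mu.
have pre la : la \in E -> exists f mu,
    [/\ f \in [fset g x | x in E]%fset, dom f = cod mu & la = mcomp f mu].
  move=> laE; have [j [mu [_ c _ e]]] := gP _ laE.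
  by exists (g la), mu; split => //; apply/imfsetP; exists la.
exists [fset g x | x in E]%fset; split => //.
- split => //.
  + move=> _ /imfsetP [la /= laE ->].
    have [Gla rla _] := hE _ laE; have [j [mu [_ c d e]]] := gP _ laE.
    have [Gg _] : G (g la) /\ G mu.
      by apply: (Gsub.2 _ _ _).1; rewrite -?e //; apply/src_rngE.
    split => //; first by rewrite -rla [in RHS]e rng_mcomp.
    case: vv => o _ <- gv; move/ffunP: d => /(_ j).
    by rewrite gv deg_idm !ffunE eqxx.
  + move=> mu Gmu rmu; have [la laE [[a b]]] := exE _ Gmu rmu.
    move=> [/= [Ga Gb] /src_rngE ca /src_rngE cb e [_ _ Gma _]].
    have [f [nu [fF cf ela]]] := pre _ laE; exists f => //.
    have cnb : dom nu = cod b by rewrite -cb ela dom_mcomp.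
    have Gnb : G (mcomp nu b).
      apply/(Gsub.2 _ _ _).2; first exact/src_rngE.
      have [Gla _ _] := hE _ laE; split => //.
      by apply: ((Gsub.2 f nu _).1 _).2; rewrite -?ela //; apply/src_rngE.
    have [x [y [t [m _ _ _ _]]]] : exists x y t,
        [/\ min_ext G mu f (x, y), G t, dom x = cod t, a = mcomp x t
          & mcomp nu b = mcomp y t].
      apply: common_ext_min_ext => //; first by rewrite cod_mcomp.
      by rewrite e ela mcompA.
    by exists (x, y).
- move=> _ /imfsetP [la /= laE ->]; have [j [mu [lt0 _ d _]]] := gP _ laE.
  by exists j => //; exists la.
Qed.

(** This is the set usually written [Ext(f; E)]. Finite alignment makes the
    union finite; otherwise [fset_set] would return the empty set. *)
Definition exts G (f : S) E : {fset S} :=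
  fset_set (\bigcup_(la in [set` E]) [set p.2 | p in min_ext G la f]).

Lemma in_exts G f E b : finitely_aligned S ->
  b \in exts G f E <-> exists la a, la \in E /\ min_ext G la f (a, b).
Proof.
move=> fa; rewrite /exts in_fset_set; last first.
  apply: bigcup_finite => [|la _]; first exact: finite_fset.
  apply: finite_image; apply: sub_finite_set (fa la f) => p.
  exact: min_ext_setT.
split=> [/set_mem [la laE [[a b'] m <-]]|[la [a [laE m]]]]; first by exists la, a.
by apply/mem_set; exists la => //; exists (a, b).
Qed.

(** A path [mu] leaving from the source of [f] is seen by [exts G f E] because
    [f mu] is seen by [E]. *)
Lemma exts_FE G v E f : finitely_aligned S -> is_sub_kgraph G -> FE G v E ->
  G f -> rng f = v -> src f \notin exts G f E -> FE G (src f) (exts G f E).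
Proof.
move=> fa Gsub [_ _ hE exE] Gf rf nsf; split.
- by exists (dom f).
- by have [] := Gsub.1 _ Gf.
- move=> b bX; split; last by move=> eb; move: nsf; rewrite -eb bX.
    by have [la [a [_ [[_ ?] _ _ _ _]]]] := (in_exts _ _ _ _ fa).1 bX.
  by have [la [a [_ [_ _ -> _ _]]]] := (in_exts _ _ _ _ fa).1 bX.
- move=> mu Gmu rmu; have cfm : dom f = cod mu by apply/src_rngE.
  have Gfm : G (mcomp f mu) by apply/(Gsub.2 _ _ _).2.
  have rfm : rng (mcomp f mu) = v by rewrite rng_mcomp.
  have [la laE [[a b]]] := exE _ Gfm rfm.
  move=> [/= [Ga Gb] /src_rngE ca /src_rngE cb e [_ _ Gma _]].
  have cma : dom mu = cod a by rewrite -ca dom_mcomp.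
  have Gmua : G (mcomp mu a) by apply/(Gsub.2 _ _ _).2; first exact/src_rngE.
  have [y [x [t [m Gt cyt eb emu]]]] : exists y x t,
      [/\ min_ext G la f (y, x), G t, dom y = cod t, b = mcomp y t
        & mcomp mu a = mcomp x t].
    apply: common_ext_min_ext; rewrite ?cod_mcomp ?mcompA // -?e //.
  have [/= [_ Gx] /src_rngE cy /src_rngE cx ex _] := m.
  have cxt : dom x = cod t.
    by rewrite -cyt -(dom_mcomp cy) ex dom_mcomp.
  exists x; first by apply/in_exts => //; exists la, y.
  have [p [q [t' [m' _ _ _ _]]]] : exists p q t',
      [/\ min_ext G mu x (p, q), G t', dom p = cod t', a = mcomp p t'
        & t = mcomp q t'] by apply: common_ext_min_ext.
  by exists (p, q).
Qed.

End Factorisation.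

(** * Gap projections of a Toeplitz-Cuntz-Krieger family *)

Section Gap.
Context {R : realType} {k : nat} {S : kgraph k} {A : cstarAlgType R}.
Context (S_fa : finitely_aligned S) (q : S -> A) (q_TCK : is_TCK_family q).
Implicit Types (la mu nu : S) (E : {fset S}) (K : set A) (a x y z : A).

Lemma cmul0r x : (0 : A) ** x = 0.
Proof. by apply: (addrI (0 ** x)); rewrite -cmulDl !addr0. Qed.

Lemma cmulr0 x : x ** (0 : A) = 0.
Proof. by apply: (addrI (x ** 0)); rewrite -cmulDr !addr0. Qed.

Lemma cmulNl x y : (- x) ** y = - (x ** y).
Proof. by apply: (addrI (x ** y)); rewrite -cmulDl !subrr cmul0r. Qed.

Lemma cmulNr x y : x ** (- y) = - (x ** y).
Proof. by apply: (addrI (x ** y)); rewrite -cmulDr !subrr cmulr0. Qed.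

Lemma star0 : star (0 : A) = 0.
Proof. by apply: (addrI (star 0)); rewrite -starD !addr0. Qed.

Lemma ideal_add K x y : is_ideal K -> K x -> K y -> K (x + y).
Proof. by move=> [_ + _ _ _]; rewrite -{2}[x]scale1r; apply. Qed.

Lemma TCK_vertex la : q (rng la) ** q la = q la.
Proof.
have [_ mul _] := q_TCK; rewrite mul ?mcomp_idl //.
by rewrite /src /rng dom_idm.
Qed.

Lemma TCK_isometry la : star (q la) ** q la = q (src la).
Proof.
have [[tck1 _] _ tck3] := q_TCK.
rewrite tck3 min_ext_diag fsbig_set1 /=.
by have [-> ->] := tck1 (src la) (ex_intro2 _ _ (dom la) I erefl).
Qed.

Lemma TCK_star_vertex v : vertices v -> star (q v) = q v.
Proof. by have [[tck1 _] _ _] := q_TCK => /tck1 []. Qed.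

Lemma TCK_vertex_idem v : vertices v -> q v ** q v = q v.
Proof. by have [[tck1 _] _ _] := q_TCK => /tck1 []. Qed.

Lemma TCK_src la : q la ** q (src la) = q la.
Proof.
have [_ mul _] := q_TCK; rewrite mul ?mcomp_idr //.
by rewrite /rng /src cod_idm.
Qed.

Lemma TCK_partial_isometry la : q la ** star (q la) ** q la = q la.
Proof. by rewrite -cmulA TCK_isometry TCK_src. Qed.

(** The product of two range projections is the sum of the range projections
    of the minimal common extensions, an expression that is symmetric. *)
Lemma range_proj_comm mu nu :
  (q mu ** star (q mu)) ** (q nu ** star (q nu)) =
  (q nu ** star (q nu)) ** (q mu ** star (q mu)).
Proof.
have star_proj la : star (q la ** star (q la)) = q la ** star (q la).
  by rewrite starM starK.
suff sa : star ((q mu ** star (q mu)) ** (q nu ** star (q nu))) =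
          (q mu ** star (q mu)) ** (q nu ** star (q nu)).
  by rewrite -sa starM !star_proj.
have -> : (q mu ** star (q mu)) ** (q nu ** star (q nu)) =
    q mu ** (star (q mu) ** q nu) ** star (q nu) by rewrite !cmulA.
have [_ mul tck3] := q_TCK; rewrite tck3 fsbig_finite //=.
(* [P] is self-adjointness of a partial sum, written in the middle factor. *)
pose P x := star (q mu ** x ** star (q nu)) = q mu ** x ** star (q nu).
rewrite (_ : \sum_(p <- fset_set (min_ext setT mu nu)) _ =
  \sum_(p <- fset_set (min_ext setT mu nu) | p \in min_ext setT mu nu)
    q p.1 ** star (q p.2)); last first.
  by rewrite big_seq_cond [RHS]big_seq_cond; apply: eq_bigl => p;
    rewrite andbT; case: (boolP (p \in fset_set _)) => // ;
    rewrite in_fset_set // => ->.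
apply: (big_ind P) => [|x y Px Py|p /set_mem [_ c1 c2 e _]]; rewrite /P.
- by rewrite cmulr0 cmul0r star0.
- by rewrite cmulDr cmulDl starD Px Py.
- rewrite cmulA mul // -cmulA -starM mul // -e.
  by rewrite starM starK.
Qed.

(** The gap projection is a product along a list; the algebra below is by
    induction on that list. *)
Let gaps (v : S) (l : seq S) : A :=
  \big[cmul/q v]_(la <- l) (q v - q la ** star (q la)).

Let gaps_cons v la l :
  gaps v (la :: l) = (q v - q la ** star (q la)) ** gaps v l.
Proof. by rewrite /gaps big_cons. Qed.

Lemma vertex_gaps v l : vertices v -> (forall la, la \in l -> rng la = v) ->
  q v ** gaps v l = gaps v l.
Proof.
move=> vv; case: l => [_|la l h].
  by rewrite /gaps big_nil TCK_vertex_idem.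
rewrite gaps_cons cmulA cmulDr TCK_vertex_idem // cmulNr cmulA.
by rewrite -(h la) ?mem_head // TCK_vertex.
Qed.

Lemma gaps_comm v l mu : vertices v -> rng mu = v ->
  gaps v l ** (q mu ** star (q mu)) = (q mu ** star (q mu)) ** gaps v l.
Proof.
move=> vv rmu; have comm_v : (q mu ** star (q mu)) ** q v =
    q v ** (q mu ** star (q mu)).
  rewrite cmulA -{2}rmu TCK_vertex -cmulA -(TCK_star_vertex vv) -starM.
  by rewrite -rmu TCK_vertex.
elim: l => [|la l IH]; first by rewrite /gaps big_nil.
rewrite gaps_cons -cmulA IH !cmulA; congr (_ ** _).
rewrite -cmulA cmulDl cmulDr cmulNl cmulNr range_proj_comm.
by rewrite comm_v !cmulA.
Qed.

(** The gap of a set is orthogonal to the range projection of each member: by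
    commutation the factor [q_v - q_la q_la^*] can be brought next to [q_la],
    which it kills. *)
Lemma gaps_mul_path v l la : vertices v ->
  (forall mu, mu \in l -> rng mu = v) -> la \in l -> gaps v l ** q la = 0.
Proof.
move=> vv; elim: l => // mu l IH h; rewrite inE.
have [-> _|_ /= lal] := eqVneq la mu; rewrite gaps_cons; last first.
  by rewrite -cmulA IH ?cmulr0 // => nu nul; apply: h; rewrite inE nul orbT.
have rmu : rng mu = v by apply: h; rewrite mem_head.
have -> : (q v - q mu ** star (q mu)) ** gaps v l ** q mu =
    (q v - q mu ** star (q mu)) ** (q mu ** star (q mu)) ** (gaps v l ** q mu).
  rewrite -!cmulA; congr (_ ** _); rewrite !cmulA -(gaps_comm l vv rmu).
  by rewrite -!cmulA TCK_isometry TCK_src.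
rewrite cmulDl cmulNl -{1}rmu !cmulA TCK_vertex TCK_partial_isometry.
by rewrite subrr !cmul0r.
Qed.

Lemma gap_mul_path v E la : vertices v ->
  (forall mu, mu \in E -> rng mu = v) -> la \in E -> gap q v E ** q la = 0.
Proof. by move=> vv h laE; apply: gaps_mul_path. Qed.

(** The difference [q_v - gap] telescopes into a sum of terms that begin with
    some [q_la]. So an element that the paths of [l] and the gap all send into
    an ideal is sent into it by [q_v] too. *)
Lemma ideal_absorb_gaps K v l a : is_ideal K -> vertices v ->
  (forall la, la \in l -> rng la = v) ->
  (forall la, la \in l -> K (a ** q la)) -> K (a ** gaps v l) -> K (a ** q v).
Proof.
move=> KI vv; have [_ _ _ Kr _] := KI.
elim: l => [|mu l IH] h hK; first by rewrite /gaps big_nil.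
have hl nu : nu \in l -> nu \in mu :: l by rewrite inE orbC => ->.
rewrite gaps_cons => Kg; apply: IH => [nu /hl /h //|nu /hl /hK //|].
rewrite -[gaps v l]vertex_gaps //; last by move=> nu /hl /h.
(* The inserted factor [q v] is split as [(q v - P) + P], with [P] the range
   projection of the first path. *)
rewrite (_ : a ** (q v ** gaps v l) = a ** ((q v - q mu ** star (q mu)) **
    gaps v l) + a ** q mu ** (star (q mu) ** gaps v l)).
  by apply: ideal_add => //; apply: Kr; apply: hK; rewrite mem_head.
rewrite -[in RHS]cmulA -cmulDr; congr (_ ** _).
by rewrite cmulDl cmulNl !cmulA subrK.
Qed.

Lemma ideal_absorb_gap K v E a : is_ideal K -> vertices v ->
  (forall la, la \in E -> rng la = v) ->
  (forall la, la \in E -> K (a ** q la)) -> K (a ** gap q v E) -> K (a ** q v).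
Proof. exact: ideal_absorb_gaps. Qed.

Lemma gap_mul_vertex v E : vertices v -> gap q v E ** q v = gap q v E.
Proof.
move=> vv; rewrite -[gap q v E]/(gaps v E); elim: (E : seq S) => [|mu l IH].
  by rewrite /gaps big_nil TCK_vertex_idem.
by rewrite gaps_cons -cmulA IH.
Qed.

(** If each path of [E] extends one of [F], then [gap F] is a subprojection of
    [gap E]: it kills every path of [E], so [gap F = gap F ** gap E]. *)
Lemma gap_coarser K v E F : is_ideal K -> vertices v ->
  (forall la, la \in E -> rng la = v) -> (forall f, f \in F -> rng f = v) ->
  (forall la, la \in E -> exists f mu,
    [/\ f \in F, dom f = cod mu & la = mcomp f mu]) ->
  K (gap q v E) -> K (gap q v F).
Proof.
move=> KI vv hE hF pre KE; have [K0 _ Kl _ _] := KI.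
rewrite -gap_mul_vertex //; apply: (@ideal_absorb_gap _ _ E) => //; last exact: Kl.
move=> la /pre [f [mu [fF c ->]]]; have [_ mul _] := q_TCK.
by rewrite -mul ?cmulA ?gap_mul_path ?cmul0r //; apply/src_rngE.
Qed.

(** If [f b = la a] with [la] in [E], then [gap E] kills [q_la], hence also
    [q_(f b)]. *)
Lemma gap_mul_ext G v E f b : vertices v ->
  (forall la, la \in E -> rng la = v) ->
  b \in exts G f E -> gap q v E ** q f ** q b = 0.
Proof.
move=> vv hE /in_exts -/(_ S_fa) [la [a [laE [_ /= ca cb e _]]]].
have [_ mul _] := q_TCK; rewrite -cmulA mul // -e -mul // cmulA.
by rewrite gap_mul_path ?cmul0r.
Qed.

(** The element [gap E q_f] kills every path of [exts G f E], so it absorbs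
    the gap of that set on the right. *)
Lemma gap_mul_exts G K v E f : is_ideal K -> vertices v ->
  (forall la, la \in E -> rng la = v) ->
  K (gap q (src f) (exts G f E)) -> K (gap q v E ** q f).
Proof.
move=> KI vv hE KX; have [K0 _ Kl _ _] := KI.
rewrite -TCK_src cmulA; apply: (@ideal_absorb_gap _ _ (exts G f E)) => //.
- by exists (dom f).
- by move=> b /in_exts -/(_ S_fa) [la [a [_ [_ _ /= -> _ _]]]].
- by move=> b bX; rewrite (gap_mul_ext vv hE bX).
- exact: Kl.
Qed.

(** Multiplying [gap X q_f^*] on the right by [q_la] with [la] in [E] gives, by
    the third Toeplitz relation, a sum of terms [gap X q_b q_a^*] over the
    minimal common extensions [f b = la a] in the whole graph. If [b] ends
    outside [H_K], it is in [X] and the term vanishes; otherwise [q_b] is in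
    [K]. Multiplication by [gap E] gives an element of [K] by hypothesis, so
    [gap X q_f^*] and [gap X = gap X q_f^* q_f] are in [K]. *)
Lemma gap_exts_ideal K v E f : is_ideal K -> vertices v ->
  (forall la, la \in E -> rng la = v) -> rng f = v -> outside q K f ->
  K (gap q v E) -> K (gap q (src f) (exts (outside q K) f E)).
Proof.
move=> KI vv hE rf Gf KE; have [K0 _ Kl Kr _] := KI.
have Gsub := outside_sub_kgraph q_TCK KI.
set X := exts _ _ _.
have vsf : vertices (src f) by exists (dom f).
have hX b : b \in X -> rng b = src f.
  by move=> /in_exts -/(_ S_fa) [la [a [_ [_ _ /= -> _ _]]]].
rewrite -gap_mul_vertex // -TCK_isometry cmulA; apply: (Kr).
have sf : star (q f) = star (q f) ** q v.
  by rewrite -(TCK_star_vertex vv) -starM -rf TCK_vertex.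
rewrite sf cmulA; apply: (@ideal_absorb_gap _ _ E) => //; last exact: Kl.
move=> la laE; have [_ _ tck3] := q_TCK; rewrite -cmulA tck3.
rewrite fsbig_finite //=; rewrite big_seq.
apply: (big_ind (fun x => K (gap q (src f) X ** x))) => [|x y Kx Ky|[b a]].
- by rewrite cmulr0.
- by rewrite cmulDr; apply: ideal_add.
rewrite in_fset_set // => /set_mem m /=; rewrite cmulA; apply: (Kr).
have [Gb|nGb] := pselect (outside q K b).
  rewrite gap_mul_path //; apply/in_exts => //; exists la, a; split => //.
  exact/min_extC/min_ext_sub.
rewrite -TCK_src; apply/Kl/Kl.
by move: nGb => /contrapT [].
Qed.

(** The degree [D] bounds the join of the degrees of the paths in [E]; the
    induction is on its total, because [exts G f E] may have more members than
    [E]: a path and an edge can have many minimal common extensions. *)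
Lemma gap_ideal_of_edges I K (D : degree k) v E : is_ideal I -> is_ideal K ->
  (forall u (F : {fset S}), Bt_ q I u F -> K (gap q u F)) ->
  (forall la i, la \in E -> (deg la i <= D i)%N) ->
  B_ q I v E -> K (gap q v E).
Proof.
move=> II KI edgeK; have Gsub := outside_sub_kgraph q_TCK II.
have [n] := ubnP (\sum_i D i)%N; elim: n D v E => // n IH D v E ltn leD [EF IE].
have [vv Gv hE _] := EF.
have rE la : la \in E -> rng la = v by move=> /hE [].
have [F [FF edgeF pre]] := edge_prefixes Gsub EF.
have [_ _ hF _] := FF.
have rF f : f \in F -> rng f = v by move=> /hF [].
have [K0 _ Kl _ _] := KI.
rewrite -gap_mul_vertex //; apply: (@ideal_absorb_gap _ _ F) => //; last first.
  apply/Kl/edgeK; split; last by move=> f /edgeF [j ? _]; exists j.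
  by split => //; apply: (gap_coarser II vv rE rF pre).
move=> f fF; have [Gf rf _] := hF _ fF; have [j df [la0 la0E lt0]] := edgeF _ fF.
have [sX|nsX] := boolP (src f \in exts (outside q I) f E).
  by rewrite -TCK_src cmulA (gap_mul_ext vv rE sX).
apply: (@gap_mul_exts (outside q I)) => //.
have ltD : (0 < D j)%N by apply: leq_trans lt0 (leD _ _ _).
(* An edge of degree [e_j] lowers the bound at [j] by one: the tail [b] of a
   minimal common extension of [la] and [f] has degree
   [(deg la \vee e_j) - e_j]. *)
apply: (IH [ffun i => D i - (i == j)]%N).
- move: ltn; rewrite ltnS; apply: leq_trans.
  rewrite (bigD1 j) //= [X in (_ < X)%N](bigD1 j) //= ffunE eqxx.
  rewrite -addSn subn1 prednK // leq_add2l; apply: leq_sum => i ne.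
  by rewrite ffunE (negPf ne) subn0.
- move=> b i /in_exts -/(_ S_fa) [la [a [laE /min_extC m]]].
  rewrite (deg_min_ext i m) df !ffunE leq_sub2r // geq_max leD // andbT.
  by case: eqP => // ->.
- split; first exact: (exts_FE S_fa Gsub EF).
  exact: (gap_exts_ideal II vv rE rf Gf IE).
Qed.

End Gap.

Theorem propositionA1 (R : realType) (k : nat) (S : kgraph k)
  (S_fa : finitely_aligned S)
  (A : cstarAlgType R) (s : S -> A) (s_univ : is_universal_CK s)
  (gamma : ('I_k -> R[i]) -> A -> A) (gamma_gauge : is_gauge_action s gamma)
  (I : set A) (I_ideal : is_ideal I) (I_inv : gauge_invariant gamma I) :
  forall (v : S) (E : {fset S}), B_ s I v E -> J_ s I (gap s v E).
Proof.
move=> v E BE K KI genK; have [[s_TCK _] _ _] := s_univ.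
apply: (gap_ideal_of_edges S_fa s_TCK (D := [ffun i => \max_(la <- E) deg la i]%N)
  I_ideal KI) BE => [u F BF|la i laE].
  by apply: genK; exists u, F.
by rewrite ffunE; apply: leq_bigmax_seq.
Qed.
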